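(* Let $p$ be a prime and $\mathcal{O}$ the valuation ring of a finite extension $E$ of $\mathbf{Q}_p$. Let $s$ be a positive integer, $n_1,\dots,n_s$ positive integers, $n=\sum_{i=1}^s n_i$, $A_i=\mathcal{O}^{n_i}$ for $1\le i\le s$, and $A=\prod_{i=1}^s A_i=\mathcal{O}^n$, with canonical projections $\varphi_i:A\twoheadrightarrow A_i$. Let $T\subset A$ be a (local complete) $\mathcal{O}$-subalgebra which is of full rank as an $\mathcal{O}$-submodule of $A$, and let $J\subset T$ be an ideal of finite index. Set $T_i=\varphi_i(T)$ and $J_i=\varphi_i(J)$. If $J$ is principal, then $$\#\prod_{i=1}^s T_i/J_i\;=\;\#\,T/J.$$
   Context: Here $A_i=\mathcal{O}^{n_i}$ and $A=\mathcal{O}^n$ are $\mathcal{O}$-algebras with coordinatewise operations, and $\mathcal{O}$-subalgebras contain the identity. $T$ is a complete local ring; each $T_i$ is then also a (local complete) $\mathcal{O}$-subalgebra of $A_i$, the maps $\varphi_i|_T:T\to T_i$ are local homomorphisms, and each $J_i$ is an ideal of finite index in $T_i$. The symbol $\#$ denotes cardinality. *)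

(* Defs.v *)
From HB Require Import structures.
From mathcomp Require Import all_boot all_order all_algebra all_field.
From mathcomp Require Import zify.
From mathcomp Require Import boolp classical_sets functions cardinality.

Set Implicit Arguments.
Unset Strict Implicit.
Unset Printing Implicit Defensive.

Import Order.TTheory GRing.Theory Num.Theory.

Local Open Scope ring_scope.

Lemma modz_dvdm (m x d : int) :
  (d %| m)%Z -> ((x %% m)%Z = x %[mod d])%Z.
Proof.
move=> dm; apply/eqP; rewrite eqz_mod_dvd /modz addrAC subrr add0r.
by rewrite rpredN dvdz_mull.
Qed.

(* Z_p is the inverse limit of the rings Z/p^n: the class at level n is
   represented by its canonical representative in {0, ..., p^n - 1}. *)
Definition padic_coherent (p : nat) (z : nat -> int) : bool :=
  `[< forall n, z n = (z n.+1 %% (p ^ n)%N)%Z >].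

(* The primality proof is a parameter only so that the ring structures below
   can be inferred from the type. *)
Record padic_int (p : nat) (p_pr : prime p) := PadicInt {
  residue :> nat -> int;
  _ : padic_coherent p residue
}.

HB.instance Definition _ (p : nat) (p_pr : prime p) :=
  [isSub for @residue p p_pr].
HB.instance Definition _ (p : nat) (p_pr : prime p) :=
  [Choice of padic_int p_pr by <:].

Section PadicIntRing.

Variables (p : nat) (p_pr : prime p).
Implicit Types x y z : padic_int p_pr.

Lemma residueS x n : x n = (x n.+1 %% (p ^ n)%N)%Z.
Proof. by case: x => f /= /asboolP. Qed.

Lemma residue_mod x n : (x n %% (p ^ n)%N)%Z = x n.
Proof. by rewrite residueS modz_mod. Qed.

Lemma padic_intP x y : (forall n, x n = y n) -> x = y.
Proof. by move=> xy; apply/val_inj/funext. Qed.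

Lemma padic_reduce_coherent (f : nat -> int) :
  (forall n, (f n.+1 = f n %[mod (p ^ n)%N])%Z) ->
  padic_coherent p (fun n => (f n %% (p ^ n)%N)%Z).
Proof.
move=> fS; apply/asboolP => n; rewrite -fS.
by rewrite expnSr PoszM modz_dvdm ?dvdz_mulr.
Qed.

Lemma residue_eqmod x n : (x n.+1 = x n %[mod (p ^ n)%N])%Z.
Proof. by rewrite -residueS residue_mod. Qed.

Fact padic_cst_subproof (c : int) n : (c = c %[mod (p ^ n)%N])%Z.
Proof. by []. Qed.

Fact padic_opp_subproof x n : (- x n.+1 = - x n %[mod (p ^ n)%N])%Z.
Proof. by rewrite -modzNm residue_eqmod modzNm. Qed.

Fact padic_add_subproof x y n :
  (x n.+1 + y n.+1 = x n + y n %[mod (p ^ n)%N])%Z.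
Proof. by rewrite -modzDm !residue_eqmod modzDm. Qed.

Fact padic_mul_subproof x y n :
  (x n.+1 * y n.+1 = x n * y n %[mod (p ^ n)%N])%Z.
Proof. by rewrite -modzMm !residue_eqmod modzMm. Qed.

Definition padic_cst (c : int) : padic_int p_pr :=
  PadicInt p_pr (padic_reduce_coherent (padic_cst_subproof c)).
Definition padic_opp x : padic_int p_pr :=
  PadicInt p_pr (padic_reduce_coherent (padic_opp_subproof x)).
Definition padic_add x y : padic_int p_pr :=
  PadicInt p_pr (padic_reduce_coherent (padic_add_subproof x y)).
Definition padic_mul x y : padic_int p_pr :=
  PadicInt p_pr (padic_reduce_coherent (padic_mul_subproof x y)).

Fact padic_addA : associative padic_add.
Proof.
by move=> x y z; apply: padic_intP => n /=;
rewrite modzDml modzDmr addrA.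
Qed.
Fact padic_addC : commutative padic_add.
Proof. by move=> x y; apply: padic_intP => n /=; rewrite addrC. Qed.
Fact padic_add0 : left_id (padic_cst 0) padic_add.
Proof.
by move=> x; apply: padic_intP => n /=;
rewrite mod0z add0r residue_mod.
Qed.
Fact padic_addN : left_inverse (padic_cst 0) padic_opp padic_add.
Proof. by move=> x; apply: padic_intP => n /=; rewrite modzDml addNr. Qed.

HB.instance Definition _ := GRing.isZmodule.Build (padic_int p_pr)
  padic_addA padic_addC padic_add0 padic_addN.

Lemma residue0 n : (0 : padic_int p_pr) n = 0.
Proof. exact: mod0z. Qed.

Fact padic_mulA : associative padic_mul.
Proof.
by move=> x y z; apply: padic_intP => n /=;
rewrite modzMml modzMmr mulrA.
Qed.
Fact padic_mulC : commutative padic_mul.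
Proof. by move=> x y; apply: padic_intP => n /=; rewrite mulrC. Qed.
Fact padic_mul1 : left_id (padic_cst 1) padic_mul.
Proof.
by move=> x; apply: padic_intP => n /=;
rewrite modzMml mul1r residue_mod.
Qed.
Fact padic_mulDl : left_distributive padic_mul padic_add.
Proof.
by move=> x y z; apply: padic_intP => n /=; rewrite modzMml modzDm mulrDl.
Qed.
Fact padic_1neq0 : padic_cst 1 != padic_cst 0.
Proof.
apply/eqP => /(congr1 (fun x : padic_int p_pr => x 1%N)) /=.
by rewrite expn1 mod0z modz_small // ltz_nat prime_gt1.
Qed.

HB.instance Definition _ := GRing.Zmodule_isComNzRing.Build (padic_int p_pr)
  padic_mulA padic_mulC padic_mul1 padic_mulDl padic_1neq0.

Definition padic_unit : {pred padic_int p_pr} :=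
  fun x => `[< exists y, y * x = 1 >].
Definition padic_inv x : padic_int p_pr :=
  if pselect (exists y, y * x = 1) is left ex then projT1 (cid ex) else x.

Fact padic_mulV : {in padic_unit, left_inverse 1 padic_inv *%R}.
Proof.
move=> x /asboolP ux; rewrite /padic_inv; case: pselect => // ex.
by case: (cid ex).
Qed.
Fact padic_unitP x y : y * x = 1 -> padic_unit x.
Proof. by move=> yx; apply/asboolP; exists y. Qed.
Fact padic_inv_out : {in [predC padic_unit], padic_inv =1 id}.
Proof.
move=> x nux; rewrite /padic_inv; case: pselect => // ex.
by case/negP: nux; apply/asboolP.
Qed.

HB.instance Definition _ := GRing.ComNzRing_hasMulInverse.Build
  (padic_int p_pr) padic_mulV padic_unitP padic_inv_out.

Lemma residue_add x k n : (x (k + n)%N = x n %[mod (p ^ n)%N])%Z.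
Proof.
elim: k => // k <-; rewrite addSn.
have dv : (Posz (p ^ n)%N %| Posz (p ^ (k + n))%N)%Z.
  by rewrite dvdzE /= dvdn_exp2l ?leq_addl.
by rewrite -(modz_dvdm (x _.+1) dv) -residueS.
Qed.

Fact padic_integral : GRing.integral_domain_axiom (padic_int p_pr).
Proof.
move=> x y xy0; case: (eqVneq x 0) => //= x0.
apply/eqP/padic_intP => n; apply/eqP/negPn/negP.
rewrite residue0 => yn0.
have [m xm0] : exists m, x m != 0.
  apply: contrapT => /forallNP h; case/negP: x0; apply/eqP/padic_intP => k.
  by rewrite residue0; apply/eqP/negPn/negP/h.
have nd (z : padic_int p_pr) k l : z k != 0 ->
    ~~ (p ^ k %| `|z (l + k)%N|)%N.
  move=> zk; apply/negP => dv; case/negP: zk.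
  apply/eqP; rewrite -residue_mod -(residue_add z l); apply/dvdz_mod0P.
  by rewrite dvdzE.
have pos (z : padic_int p_pr) k l : z k != 0 -> (0 < `|z (l + k)%N|)%N.
  move=> zk; rewrite lt0n; apply/eqP => z0.
  by move: (nd z k l zk); rewrite z0 dvdn0.
have /(congr1 (fun z : padic_int p_pr => z (n + m)%N)) := xy0.
rewrite residue0 /= => /dvdz_mod0P; rewrite dvdzE abszM /= => dv.
have xp := pos _ _ n xm0; have yp := pos _ _ m yn0.
have xn := nd _ _ n xm0; have yn := nd _ _ m yn0.
rewrite [(m + n)%N]addnC in yp yn.
move: dv xn yn; rewrite !pfactor_dvdn ?muln_gt0 ?xp ?yp // lognM //.
rewrite -!ltnNge => h hx hy.
lia.
Qed.

HB.instance Definition _ :=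
  GRing.ComUnitRing_isIntegral.Build (padic_int p_pr) padic_integral.

(* For z != 0 this is the largest k such that p^k divides z, since z n is the
   class of z modulo p^n. *)
Definition padic_int_val (z : padic_int p_pr) : nat :=
  if pselect (exists k, z k.+1 != 0) is left ex then ex_minn ex else 0%N.

End PadicIntRing.

Definition padic (p : nat) (p_pr : prime p) : fieldType :=
  {fraction (padic_int p_pr)}.

Local Notation "x %:F" := (FracField.tofrac x).

Section ValuationRing.

Variables (p : nat) (p_pr : prime p) (E : fieldExtType (padic p_pr)).

(* The additive valuation of a finite extension E of Q_p, extending the p-adic
   one and so normalized by v(p) = 1; it exists and is unique, and its values
   lie in (1/e)Z for e the ramification index.  The value at 0 (morally +oo)
   is left unconstrained. *)
Record valuation_ext := ValuationExt {
  valuation :> E -> rat;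
  valuationM : forall x y : E, x != 0 -> y != 0 ->
    valuation (x * y) = valuation x + valuation y;
  valuationD : forall x y : E, x != 0 -> y != 0 -> x + y != 0 ->
    Order.min (valuation x) (valuation y) <= valuation (x + y);
  valuation_padic : forall a b : padic_int p_pr, a != 0 -> b != 0 ->
    valuation ((a%:F / b%:F)%:A) =
      (padic_int_val a)%:R - (padic_int_val b)%:R
}.

Variable v : valuation_ext.

Definition in_valuation_ring (x : E) : bool := (x == 0) || (0 <= v x).

Fact valuation1 : v 1 = 0.
Proof.
have := valuationM v (oner_neq0 E) (oner_neq0 E).
by rewrite mulr1 => /eqP; rewrite -subr_eq subrr eq_sym => /eqP.
Qed.

Fact valuationN x : x != 0 -> v (- x) = v x.
Proof.
move=> x0; have N0 : (-1 : E) != 0 by rewrite oppr_eq0 oner_eq0.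
have := valuationM v N0 N0; rewrite mulrNN mulr1 valuation1 => /esym/eqP.
rewrite -mulr2n mulrn_eq0 /= => /eqP vN.
by rewrite -mulN1r valuationM // vN add0r.
Qed.

Fact in_valuation_ring_subring : GRing.subring_closed in_valuation_ring.
Proof.
split; first by rewrite unfold_in /in_valuation_ring valuation1 lexx orbT.
- move=> x y; rewrite !unfold_in /in_valuation_ring.
  case: (eqVneq x 0) => [->|x0] /=.
    by rewrite add0r oppr_eq0; case: (eqVneq y 0) => //= y0; rewrite valuationN.
  case: (eqVneq y 0) => [->|y0] /= vx vy; first by rewrite subr0 vx orbT.
  case: (eqVneq (x - y) 0) => //= xy0.
  have Ny0 : - y != 0 by rewrite oppr_eq0.
  by apply: le_trans (valuationD v x0 Ny0 xy0); rewrite le_min vx valuationN.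
- move=> x y; rewrite !unfold_in /in_valuation_ring mulf_eq0.
  case: (eqVneq x 0) => //= x0; case: (eqVneq y 0) => //= y0 vx vy.
  by rewrite valuationM // addr_ge0.
Qed.

HB.instance Definition _ :=
  GRing.isSubringClosed.Build E in_valuation_ring in_valuation_ring_subring.

Record valuation_ring := ValuationRing {
  valuation_ring_val : E;
  _ : in_valuation_ring valuation_ring_val
}.

HB.instance Definition _ := [isSub for valuation_ring_val].
HB.instance Definition _ := [Choice of valuation_ring by <:].
HB.instance Definition _ :=
  [SubChoice_isSubComNzRing of valuation_ring by <:].

End ValuationRing.

HB.instance Definition _ (aT : finType) (R : comPzRingType) :=
  GRing.PzRing_hasCommutativeMul.Build {ffun aT -> R} (@ffun_mulC aT R).

(* The algebra R^n, with coordinatewise operations; R^o is R as a module over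
   itself. *)
Notation coord_alg R n := {ffun 'I_n -> R^o}.

Section SubAlgebras.

Local Open Scope classical_set_scope.

Definition is_subalgebra (R : comNzRingType) (n : nat)
    (T : set (coord_alg R n)) : Prop :=
  [/\ T 1,
      forall (c : R) x y, T x -> T y -> T (c *: x + y)
    & forall x y, T x -> T y -> T (x * y)].

(* The rank of a submodule M: the largest size of a linearly independent
   family of elements of M. *)
Definition lin_indep (R : comNzRingType) (M : lmodType R) (k : nat)
    (u : 'I_k -> M) : Prop :=
  forall c : 'I_k -> R, \sum_i c i *: u i = 0 -> forall i, c i = 0.

Definition has_rank (R : comNzRingType) (M : lmodType R) (N : set M)
    (r : nat) : Prop :=
  (exists u : 'I_r -> M, (forall i, N (u i)) /\ lin_indep u) /\
  (forall k (u : 'I_k -> M), (forall i, N (u i)) -> lin_indep u ->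
     (k <= r)%N).

(* Below S is meant to be a subring of B and ideals are ideals of S. *)
Variable B : comPzRingType.
Implicit Types S I m : set B.

Definition is_ideal S I : Prop :=
  [/\ I `<=` S, I 0, forall x y, I x -> I y -> I (x + y)
    & forall s x, S s -> I x -> I (s * x)].

Definition principal_ideal S I : Prop :=
  exists2 a, S a & I = [set s * a | s in S].

Definition maximal_ideal S m : Prop :=
  [/\ is_ideal S m, m != S
    & forall I, is_ideal S I -> m `<=` I -> I = m \/ I = S].

Definition ideal_mul S I m : set B :=
  \bigcap_(K in [set K | is_ideal S K /\
                  forall x y, I x -> m y -> K (x * y)]) K.

Fixpoint ideal_pow S m (k : nat) : set B :=
  if k is k'.+1 then ideal_mul S (ideal_pow S m k') m else S.

Definition adic_complete S m : Prop :=
  (forall x, (forall k, ideal_pow S m k x) -> x = 0) /\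
  (forall u : nat -> B, (forall k, S (u k)) ->
     (forall k, ideal_pow S m k (u k.+1 - u k)) ->
     exists2 x, S x & forall k, ideal_pow S m k (x - u k)).

Definition complete_local S : Prop :=
  exists m, [/\ maximal_ideal S m, forall m', maximal_ideal S m' -> m' = m
              & adic_complete S m].

Definition quotient_set S I : set (set B) :=
  [set [set y | S y /\ I (y - x)] | x in S].

End SubAlgebras.

(* The projection of R^n, n = n_1 + ... + n_s, onto its i-th factor R^(n_i). *)
Definition block_proj (R : comNzRingType) (s : nat) (n : 'I_s -> nat)
    (i : 'I_s) (a : coord_alg R (\sum_(j < s) n j)) : coord_alg R (n i) :=
  [ffun j => a (tagnat.Rank i j)].

(* Main.v *)
From HB Require Import structures.
Require Import Defs.
From mathcomp Require Import all_boot all_order all_algebra all_field.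
From mathcomp Require Import boolp classical_sets functions cardinality.

(** Write [X : Y] for the index of an additive subgroup Y of X, and J = aT.
    All coordinates of a are nonzero: T contains the scalars, so a vanishing
    coordinate would make the finite quotient T/aT surject onto the infinite
    ring O.  Hence multiplication by a maps A/T bijectively onto aA/aT, and
    counting A/aT along the chains A > T > aT and A > aA > aT gives
      [A : T] [T : aT] = [A : aA] [aA : aT] = [A : aA] [A : T].
    When [A : T] is finite it cancels, and #T/J = #A/aA is the product of the
    #O/a_jO over all coordinates j, an expression in which T no longer occurs
    ([index_multiples]).  The same formula holds for each T_i with its
    generator, the projection of a, and the product over the coordinates of A
    is the product over the blocks of the products over the coordinates of
    each block ([prod_blocks]).

    Finiteness of [A : T].  As T has full rank, Cramer's rule gives a nonzero
    d in O with dA inside T ([full_rank_conductor]), so it is enough that O/dO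
    is finite.  This comes from the finiteness of T/aT.  Each O/a_jO is a
    quotient of T/aT ([quotient_coord_index]), hence finite, and so are the
    O/a_j^kO; if some a_j is not a unit, then d divides a power of a_j because
    the value group is archimedean ([valuation_ring_archimedean]), and O/dO is
    finite too.  If every a_j is a unit, then a is a unit of T, so that aT = T
    and both sides of #T/aT = #A/aA are 1 ([multiples_subalgebra_unit]).

    The count is carried out over any integral domain in which a nonzero
    element divides some power of each nonzero nonunit, and indices are
    handled through systems of representatives. *)

Set Implicit Arguments.
Unset Strict Implicit.
Unset Printing Implicit Defensive.

Import Order.TTheory GRing.Theory Num.Theory.

Local Open Scope ring_scope.
Local Notation "x %:F" := (FracField.tofrac x).
Local Open Scope classical_set_scope.
Local Open Scope card_scope.

(** * Cardinals of finite types and of finite products *)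

Lemma card_eq_finType (K : finType) : [set: K] #= `I_#|K|.
Proof.
apply: (@card_eq_trans _ _ _ _ [set: 'I_#|K|]); last first.
  by rewrite card_eq_sym; exact: card_II.
suff <- : @enum_val K K @` [set: 'I_#|K|] = [set: K].
  by apply: inj_card_eq => i j _ _; exact: enum_val_inj.
by apply/seteqP; split=> // x _; exists (enum_rank x); rewrite // enum_rankK.
Qed.

Lemma card_dffun_ord (I : finType) (m : I -> nat) :
  #|{dffun forall i, 'I_(m i)}| = (\prod_i m i)%N.
Proof.
rewrite card_dep_ffun foldrE big_map big_enum /=.
by apply: eq_bigr => i _; rewrite card_ord.
Qed.

Lemma card_eq_pi (I : finType) (X : I -> Type) (m : I -> nat)
    (q : forall i, 'I_(m i) -> X i) :
  (forall i, injective (q i)) ->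
  [set f : forall i, X i | forall i, range (q i) (f i)]
    #= `I_(\prod_i m i)%N.
Proof.
move=> q_inj; pose K : finType := {dffun forall i, 'I_(m i)}.
pose h (g : K) : forall i, X i := fun i => q i (g i).
have -> : [set f : forall i, X i | forall i, range (q i) (f i)] = range h.
  apply/seteqP; split=> f /=; last by case=> g _ <- i; exists (g i).
  move=> qf; have fP i : exists k, q i k = f i.
    by have [k _ <-] := qf i; exists k.
  pose g : K := [ffun i => projT1 (cid (fP i))].
  exists g => //; apply: functional_extensionality_dep => i.
  by rewrite /h ffunE; case: cid.
apply: (@card_eq_trans _ _ _ _ [set: K]); last first.
  by have := card_eq_finType K; rewrite card_dffun_ord.
apply: inj_card_eq => g g' _ _ gg'; apply/ffunP => i.
by apply: (@q_inj i); exact: (congr1 (@^~ i) gg').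
Qed.

(** * Indices of additive subgroups *)

Section Index.

Variable B : comPzRingType.
Implicit Types S I J : set B.

Definition subgroup I := I 0 /\ forall x y, I x -> I y -> I (x - y).

(** The representatives are not required to lie in S, which makes coverings
    easy to restrict to subgroups of S. *)
Definition covers S I (K : finType) (r : K -> B) :=
  forall x, S x -> exists k, I (x - r k).

Definition separated I (K : finType) (r : K -> B) :=
  forall k l, I (r k - r l) -> k = l.

Definition transversal S I (K : finType) (r : K -> B) :=
  [/\ forall k, S (r k), covers S I r & separated I r].

Definition has_index S I (m : nat) :=
  exists r : 'I_m -> B, transversal S I r.

Lemma subgroupN I x : subgroup I -> I x -> I (- x).
Proof. by case=> I0 IB Ix; rewrite -sub0r; exact: IB. Qed.

Lemma subgroupD I x y : subgroup I -> I x -> I y -> I (x + y).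
Proof.
by move=> Isub Ix Iy; rewrite -[y]opprK; apply: Isub.2 => //; exact: subgroupN.
Qed.

Lemma subgroup_sym I x y : subgroup I -> I (x - y) -> I (y - x).
Proof. by move=> Isub /(subgroupN Isub); rewrite opprB. Qed.

Lemma subgroup_trans I y x z :
  subgroup I -> I (x - y) -> I (y - z) -> I (x - z).
Proof. by move=> Isub Ixy /(subgroupD Isub Ixy); rewrite subrKA. Qed.

Lemma coset_eq S I x y :
  subgroup I -> I (x - y) ->
  [set z | S z /\ I (z - x)] = [set z | S z /\ I (z - y)].
Proof.
move=> Isub Ixy; apply/seteqP; split=> z [Sz Iz]; split=> //.
  exact: subgroup_trans Iz Ixy.
by apply: (subgroup_trans Isub Iz); exact: subgroup_sym.
Qed.

(** Sending an element of a separated family to a covering coset that contains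
    it is injective. *)
Lemma card_separated_le S I (K L : finType) (r : K -> B) (c : L -> B) :
  subgroup I -> (forall k, S (r k)) -> separated I r -> covers S I c ->
  (#|K| <= #|L|)%N.
Proof.
move=> Isub Sr rsep cov; have cr k := cov _ (Sr k).
pose f k := projT1 (cid (cr k)).
have fP k : I (r k - c (f k)) by rewrite /f; case: cid.
apply: (@leq_card _ _ f) => k l fkl; apply: rsep.
have -> : r k - r l = (r k - c (f k)) - (r l - c (f l)).
  by rewrite fkl opprB addrA subrK.
exact: Isub.2.
Qed.

Lemma has_index_unique S I m m' :
  subgroup I -> has_index S I m -> has_index S I m' -> m = m'.
Proof.
move=> Isub [r [Sr rcov rsep]] [r' [Sr' rcov' rsep']]; apply/eqP.
rewrite eqn_leq -[m]card_ord -[m']card_ord.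
apply/andP; split; first exact: (card_separated_le Isub Sr rsep rcov').
exact: (card_separated_le Isub Sr' rsep' rcov).
Qed.

Lemma has_index_gt0 S I m : S 0 -> has_index S I m -> (0 < m)%N.
Proof. by move=> S0 [r [_ rcov _]]; have [[]] := rcov 0 S0; case: m r rcov. Qed.

Lemma transversal_index S I (K : finType) (r : K -> B) :
  transversal S I r -> has_index S I #|K|.
Proof.
case=> Sr rcov rsep; exists (r \o enum_val); split=> [k|x /rcov[k Ik]|k l].
- exact: Sr.
- by exists (enum_rank k); rewrite /= enum_rankK.
- by move=> /rsep /enum_val_inj.
Qed.

Lemma has_index_refl S : subgroup S -> has_index S S 1.
Proof.
move=> Ssub; exists (fun=> 0); split=> [_|x Sx|k l _].
- exact: Ssub.1.
- by exists ord0; rewrite subr0.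
- by rewrite !ord1.
Qed.

(** Tower formula: the sums of a representative of S/J and a representative of
    J/I represent S/I. *)
Lemma has_index_mul S J I k l :
  subgroup S -> subgroup J -> J `<=` S -> I `<=` J ->
  has_index S J k -> has_index J I l -> has_index S I (k * l).
Proof.
move=> Ssub Jsub JS IJ [r [Sr rcov rsep]] [t [Jt tcov tsep]].
rewrite -[k]card_ord -[l]card_ord -card_prod.
apply: (@transversal_index _ _ _ (fun u : 'I_k * 'I_l => r u.1 + t u.2)).
split=> [[i j]|x /rcov[i /tcov[j xij]]|[i j] [i' j'] /=].
- by apply: subgroupD => //; apply: JS.
- by exists (i, j) => /=; rewrite opprD addrA.
- move=> Iij; have ii' : i = i'.
    apply: rsep.
    have -> : r i - r i' = (r i + t j - (r i' + t j')) - (t j - t j').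
      by rewrite opprD addrACA addrK.
    by apply: Jsub.2; [apply: IJ | apply: Jsub.2].
  move: Iij; rewrite ii' opprD addrACA subrr add0r.
  by move=> /tsep ->.
Qed.

Lemma quotient_set_range S I (K : finType) (r : K -> B) :
  subgroup I -> transversal S I r ->
  let q k := [set y | S y /\ I (y - r k)] in
  injective q /\ quotient_set S I = range q.
Proof.
move=> Isub [Sr rcov rsep] q.
split=> [k l qkl|].
  suff [] : q l (r k) by move=> _ /rsep.
  by rewrite -qkl; split; [exact: Sr | rewrite subrr; exact: Isub.1].
apply/seteqP; split=> _ [x Sx <-].
  by have [k Ik] := rcov x Sx; exists k => //; exact/esym/coset_eq.
by exists (r x); first exact: Sr.
Qed.

Lemma card_quotient_set S I m :
  subgroup I -> has_index S I m -> quotient_set S I #= `I_m.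
Proof.
move=> Isub [r /(quotient_set_range Isub)[q_inj ->]].
apply: (@card_eq_trans _ _ _ _ [set: 'I_m]).
  by apply: inj_card_eq => k l _ _; exact: q_inj.
by rewrite card_eq_sym; exact: card_II.
Qed.

Lemma finite_quotient_index S I :
  subgroup I -> finite_set (quotient_set S I) -> exists m, has_index S I m.
Proof.
move=> Isub /finite_setP[m]; rewrite card_eq_sym => Qm.
have /card_set_bijP[q [q_fun q_inj q_surj]] : [set: 'I_m] #= quotient_set S I.
  by rewrite -(card_eql card_II).
have qP k : exists x, S x /\ [set y | S y /\ I (y - x)] = q k.
  by have [x Sx <-] := q_fun k Logic.I; exists x.
pose r k := projT1 (cid (qP k)).
have rP k : S (r k) /\ [set y | S y /\ I (y - r k)] = q k.
  by rewrite /r; case: cid.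
exists m, r; split=> [k|x Sx|k l Ikl]; first exact: (rP k).1.
  have [|k _ qk] := q_surj [set y | S y /\ I (y - x)]; first by exists x.
  have : q k x by rewrite qk; split=> //; rewrite subrr; exact: Isub.1.
  by rewrite -(rP k).2 => -[_ Ixk]; exists k.
apply: q_inj; rewrite ?inE // -(rP k).2 -(rP l).2.
exact: coset_eq.
Qed.

(** A covering family may repeat classes or have members outside S, but it
    bounds the number of classes, and this is what lets finite index pass to
    larger I and to smaller S. *)
Lemma covers_index S I (K : finType) (c : K -> B) :
  subgroup I -> covers S I c -> exists m, has_index S I m.
Proof.
move=> Isub cov; apply: finite_quotient_index => //.
pose q k := [set y | S y /\ I (y - c k)].
apply: (@sub_finite_set _ _ (range q)); last exact: finite_image.
move=> _ [x Sx <-]; have [k Ik] := cov x Sx; exists k => //.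
exact/esym/coset_eq.
Qed.

End Index.

Lemma has_index_scale (B : comPzRingType) (S I : set B) (a : B) m :
  (forall x, x * a = 0 -> x = 0) ->
  has_index S I m ->
  has_index [set x * a | x in S] [set x * a | x in I] m.
Proof.
move=> a_reg [r [Sr rcov rsep]]; exists (fun k => r k * a).
split=> [k|_ [x /rcov[k Ik] <-]|k l [x Ix xa]].
- by exists (r k).
- by exists k; exists (x - r k); rewrite ?mulrBl.
- apply: rsep; suff <- : x = r k - r l by [].
  by apply/eqP; rewrite -subr_eq0; apply/eqP/a_reg; rewrite mulrBl xa mulrBl subrr.
Qed.

(** * Principal multiples and coordinate algebras *)

Local Notation multiples S a := [set x * a | x in S].

Lemma subgroup_multiples (B : comPzRingType) (S : set B) (a : B) :
  subgroup S -> subgroup (multiples S a).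
Proof.
move=> [S0 SB]; split; first by exists 0; rewrite ?mul0r.
by move=> _ _ [x Sx <-] [y Sy <-]; exists (x - y); rewrite ?mulrBl //; exact: SB.
Qed.

Lemma subgroupT (B : comPzRingType) : subgroup [set: B].
Proof. by []. Qed.

(** In the chain R > cR > c^(k+1) R the last step is the image of R > c^k R
    under multiplication by c. *)
Lemma has_index_multiplesX (R : idomainType) (c : R) m k :
  c != 0 -> has_index [set: R] (multiples [set: R] c) m ->
  has_index [set: R] (multiples [set: R] (c ^+ k)) (m ^ k).
Proof.
move=> c0 cm; elim: k => [|k IHk].
  suff -> : multiples [set: R] (c ^+ 0) = [set: R].
    exact: has_index_refl.
  by apply/seteqP; split=> // x _; exists x; rewrite // mulr1.
rewrite expnS; apply: has_index_mul cm _ => //.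
- exact: subgroup_multiples.
- by move=> _ [x _ <-]; exists (x * c ^+ k); rewrite // exprSr mulrA.
have -> : multiples [set: R] (c ^+ k.+1)
        = multiples (multiples [set: R] (c ^+ k)) c.
  apply/seteqP; split=> [_ [x _ <-]|_ [_ [x _ <-] <-]].
    by exists (x * c ^+ k); [exists x | rewrite exprSr mulrA].
  by exists x; rewrite // exprSr mulrA.
apply: has_index_scale IHk => x /eqP.
by rewrite mulf_eq0 (negPf c0) orbF => /eqP.
Qed.

Section CoordAlg.

Variables (R : idomainType) (n : nat).
Implicit Types (a x y : coord_alg R n) (T : set (coord_alg R n)).

Lemma has_index_coord a (m : 'I_n -> nat) :
  (forall j, has_index [set: R] (multiples [set: R] (a j)) (m j)) ->
  has_index [set: coord_alg R n] (multiples [set: coord_alg R n] a)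
    (\prod_j m j)%N.
Proof.
move=> am; pose r j := projT1 (cid (am j)).
have rP j : transversal [set: R] (multiples [set: R] (a j)) (r j).
  by rewrite /r; case: cid.
rewrite -card_dffun_ord.
pose t (g : {dffun forall j, 'I_(m j)}) : coord_alg R n := [ffun j => r j (g j)].
apply: (@transversal_index _ _ _ _ t); split=> // [x _|g g' [x _ xa]].
  have xP j : exists ky : 'I_(m j) * R, ky.2 * a j = x j - r j ky.1.
    by have [_ /(_ (x j) Logic.I)[k [y _ e]] _] := rP j; exists (k, y).
  pose ky j := projT1 (cid (xP j)).
  have kyP j : (ky j).2 * a j = x j - r j (ky j).1 by rewrite /ky; case: cid.
  exists [ffun j => (ky j).1], [ffun j => (ky j).2] => //.
  by apply/ffunP => j; rewrite !ffunE kyP.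
apply/ffunP => j; have [_ _] := rP j; apply.
by exists (x j) => //; move/ffunP/(_ j): xa; rewrite !ffunE.
Qed.

(** Cramer's rule: if the rows of M are independent vectors of T, then
    det M . x = x adj(M) M is a combination of these rows for every x. *)
Lemma full_rank_conductor T :
  is_subalgebra T -> has_rank T n ->
  exists2 d : R, d != 0 & forall x, T (d *: x).
Proof.
move=> [T1 TD TM] [[u [Tu u_free]] _].
pose M : 'M[R]_n := \matrix_(i, k) u i k.
exists (\det M).
  apply/det0P => -[w w0 wM]; case/negP: w0; apply/eqP/rowP => i; rewrite mxE.
  apply: (u_free (fun i => w 0 i)); apply/ffunP => k; rewrite sum_ffunE [RHS]ffunE.
  transitivity ((w *m M) 0 k); last by rewrite wM mxE.
  by rewrite mxE; apply: eq_bigr => j _; rewrite !ffunE mxE.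
move=> x.
have T0 : T 0.
  by have := TD (-1) 1 1 T1 T1; rewrite scaleN1r addNr.
have Tsum (c : 'I_n -> R) : T (\sum_i c i *: u i).
  apply: (big_ind T T0) => [y z Ty Tz|i _].
    by have := TD 1 y z Ty Tz; rewrite scale1r.
  by have := TD (c i) (u i) 0 (Tu i) T0; rewrite addr0.
suff -> : \det M *: x = \sum_i (\sum_k x k * \adj M k i) *: u i by [].
apply/ffunP => l; rewrite sum_ffunE.
have /matrixP E := mul_adj_mx M.
transitivity (\sum_k x k * (\adj M *m M) k l).
  rewrite (bigD1 l) //= big1 ?addr0 => [|k kl].
    by rewrite E !mxE eqxx mulr1n ffunE mulrC.
  by rewrite E !mxE (negPf kl) mulr0n mulr0.
under eq_bigr do rewrite mxE mulr_sumr.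
rewrite exchange_big /=; apply: eq_bigr => i _.
rewrite ffunE; transitivity ((\sum_k (x k : R) * \adj M k i) * u i l) => //.
rewrite mulr_suml; apply: eq_bigr => k _.
by rewrite !mxE mulrA.
Qed.

Lemma subgroup_subalgebra T : is_subalgebra T -> subgroup T.
Proof.
case=> T1 TD _.
have TB x y : T x -> T y -> T (x - y).
  by move=> Tx Ty; have := TD (-1) y x Ty Tx; rewrite scaleN1r addrC.
by split=> //; have := TB _ _ T1 T1; rewrite subrr.
Qed.

(** The characteristic polynomial of multiplication by a has a unit as its
    constant term, so the inverse of a is a polynomial in a.  In elements: the
    product of the a - a_j vanishes, its k-th coordinate having the factor
    a_k - a_k, and modulo aT it is the product of the scalars - a_j, a unit. *)
Lemma multiples_subalgebra_unit T a :
  is_subalgebra T -> T a -> (forall j, a j \is a @GRing.unit R) ->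
  multiples T a = T.
Proof.
move=> Talg Ta ua; have [T0 TB] := subgroup_subalgebra Talg.
have [T1 TD TM] := Talg.
pose C (c : R) : coord_alg R n := [ffun => c].
have TC c : T (C c).
  suff -> : C c = c *: (1 : coord_alg R n) + 0 by exact: TD.
  by apply/ffunP => k; rewrite addr0 !ffunE [_ *: _]mulr1.
have TA x y : T x -> T y -> T (x + y).
  by move=> Tx Ty; have := TD 1 x y Tx Ty; rewrite scale1r.
have step (r : seq 'I_n) : exists2 t, T t &
    \prod_(j <- r) (a - C (a j)) = t * a + C (\prod_(j <- r) - (a j : R)).
  elim: r => [|j r [t Tt IHr]].
    by exists 0; rewrite // !big_nil mul0r add0r.
  exists ((a - C (a j)) * t + C (\prod_(j <- r) - (a j : R))).
    by apply: TA => //; apply: TM => //; exact: TB.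
  rewrite !big_cons IHr mulrDr mulrA [in RHS]mulrDl -addrA; congr (_ + _).
  by apply/ffunP => k; rewrite !ffunE mulrBl mulNr mulrC.
have [t Tt] := step (index_enum 'I_n).
have -> : \prod_j (a - C (a j)) = 0.
  by apply/ffunP => k; rewrite (bigD1 k) //= !ffunE subrr mul0r.
set c := \prod_j _ => /eqP; rewrite eq_sym addr_eq0 => /eqP ta.
have uc : c \is a GRing.unit.
  by rewrite unitr_prod // => j _; rewrite unitrN.
have aE : 1 = - (C c^-1 * t) * a.
  rewrite mulNr -mulrA ta mulrN opprK.
  by apply/ffunP => k; rewrite !ffunE mulVr.
apply/seteqP; split=> [_ [x Tx <-]|x Tx]; first exact: TM.
exists (x * - (C c^-1 * t)); last by rewrite -mulrA -aE mulr1.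
have Tct : T (C c^-1 * t) by exact: TM.
by apply: TM => //; rewrite -sub0r; exact: TB.
Qed.

End CoordAlg.

(** T contains the scalars, so that evaluation at a coordinate maps T onto
    R. *)
Lemma quotient_coord_index (R : idomainType) (n : nat)
    (T : set (coord_alg R n)) (a : coord_alg R n) :
  is_subalgebra T -> finite_set (quotient_set T (multiples T a)) ->
  forall j, exists m, has_index [set: R] (multiples [set: R] (a j)) m.
Proof.
move=> Talg Tfin j; have Tsub := subgroup_subalgebra Talg.
have [m [r [_ rcov _]]] :=
  finite_quotient_index (subgroup_multiples a Tsub) Tfin.
apply: (@covers_index _ _ _ _ (fun k => r k j)).
  exact: subgroup_multiples.
move=> c _; have Tc : T (c *: (1 : coord_alg R n)).
  have [T1 TD _] := Talg.
  by have := TD c 1 0 T1 Tsub.1; rewrite addr0.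
have [k [y _ ya]] := rcov _ Tc; exists k; exists (y j) => //.
by move/ffunP/(_ j): ya; rewrite !ffunE [_ *: _]mulr1.
Qed.

(** If a_j = 0, the finite index of the zero ideal of R contradicts the
    distinctness of the integers in R. *)
Lemma finite_quotient_neq0 (R : idomainType) (n : nat)
    (T : set (coord_alg R n)) (a : coord_alg R n) :
  (forall k, (k%:R == 0 :> R) = (k == 0)%N) -> is_subalgebra T ->
  finite_set (quotient_set T (multiples T a)) -> forall j, a j != 0.
Proof.
move=> char0 Talg Tfin j; apply/eqP => aj0.
have [m [r [_ rcov _]]] := quotient_coord_index Talg Tfin j.
have sub := subgroup_multiples (a j) (subgroupT R).
have sep : separated (multiples [set: R] (a j)) (fun i : 'I_m.+1 => i%:R).
  have lt_neq (k l : nat) : (k < l)%N -> (k%:R == l%:R :> R) = false.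
    move=> kl; rewrite eq_sym -subr_eq0 -natrB ?(ltnW kl) // char0.
    by rewrite subn_eq0 leqNgt kl.
  move=> k l [x _]; rewrite aj0 mulr0 => /esym/eqP; rewrite subr_eq0 => kl.
  apply: val_inj; case: (ltngtP k l) => // /lt_neq; first by rewrite kl.
  by rewrite eq_sym kl.
have := card_separated_le sub (fun=> Logic.I) sep rcov.
by rewrite !card_ord ltnn.
Qed.

(** * The index of a principal ideal *)

(** For a valuation ring this says that the value group is archimedean. *)
Definition archimedean_divisibility (R : idomainType) :=
  forall c d : R, c != 0 -> d != 0 ->
    c \is a GRing.unit \/ exists k e, c ^+ k = e * d.

(** The index of aT does not depend on T: with q = [A : T], both chains
    A > T > aT and A > aA > aT compute [A : aT], and [aA : aT] = q cancels. *)
Lemma index_multiples (R : idomainType) (n : nat) (T : set (coord_alg R n))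
    (d : R) (a : coord_alg R n) (m : 'I_n -> nat) :
  archimedean_divisibility R ->
  is_subalgebra T -> d != 0 -> (forall x, T (d *: x)) ->
  T a -> (forall j, a j != 0) ->
  (forall j, has_index [set: R] (multiples [set: R] (a j)) (m j)) ->
  has_index T (multiples T a) (\prod_j m j).
Proof.
move=> archR Talg d0 dT Ta a0 am.
have Tsub := subgroup_subalgebra Talg.
have aTsub : subgroup (multiples T a) by exact: subgroup_multiples.
have aTT : multiples T a `<=` T by case: Talg => _ _ TM _ [x Tx <-]; exact: TM.
have [ua|] := pselect (forall j, a j \is a @GRing.unit R).
  rewrite multiples_subalgebra_unit // big1 => [|j _].
    exact: has_index_refl.
  apply: (has_index_unique (subgroup_multiples _ (subgroupT R)) (am j)).
  suff -> : multiples [set: R] (a j) = [set: R] by exact: has_index_refl.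
  apply/seteqP; split=> // x _; exists (x / a j) => //.
  by rewrite mulrVK.
move=> /existsNP[j /negP nuj].
(* A nonunit coordinate a_j makes R/dR finite, and dA is contained in T. *)
have [q Tq] : exists q, has_index [set: coord_alg R n] T q.
  have [|[k [e aje]]] := archR (a j) d (a0 j) d0; first by rewrite (negPf nuj).
  pose b : coord_alg R n := [ffun=> a j ^+ k].
  have bm l : has_index [set: R] (multiples [set: R] (b l)) (m j ^ k)%N.
    by rewrite ffunE; exact: has_index_multiplesX.
  have [r [_ rcov _]] := has_index_coord bm.
  apply: (@covers_index _ _ _ _ r) => // x /rcov[i [y _ xy]]; exists i.
  suff <- : d *: (e *: y) = x - r i by exact: dT.
  rewrite -xy; apply/ffunP => l; rewrite !ffunE aje [RHS]mulrC.
  by rewrite [LHS]mulrA [d * e]mulrC.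
have a_reg x : x * a = 0 -> x = 0.
  move=> /ffunP xa; apply/ffunP => l; move/eqP: (xa l).
  by rewrite !ffunE mulf_eq0 (negPf (a0 l)) orbF => /eqP.
have AaT : has_index [set: coord_alg R n] (multiples T a) (\prod_j m j * q).
  apply: (@has_index_mul _ _ (multiples [set: coord_alg R n] a)) => //.
  - exact: subgroup_multiples.
  - by move=> _ [x Tx <-]; exists x.
  - exact: has_index_coord.
  - exact: has_index_scale.
have [t Tt] : exists t, has_index T (multiples T a) t.
  have [r [_ rcov _]] := AaT.
  by apply: (@covers_index _ _ _ _ r) => // x _; exact: rcov.
have AaT' := has_index_mul (subgroupT _) Tsub (fun _ _ => Logic.I) aTT Tq Tt.
have /eqP := has_index_unique aTsub AaT AaT'.
rewrite mulnC eqn_pmul2l ?(has_index_gt0 _ Tq) // => /eqP ->.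
exact: Tt.
Qed.

(** * The valuation ring *)

Section ValuationRingDomain.

Variables (p : nat) (p_pr : prime p) (E : fieldExtType (padic p_pr)).
Variable v : valuation_ext E.
Local Notation O := (valuation_ring v).
Implicit Types x y : O.

Definition valuation_ring_unit : {pred O} :=
  fun x => `[< exists y, y * x = 1 >].
Definition valuation_ring_inv x : O :=
  if pselect (exists y, y * x = 1) is left ex then projT1 (cid ex) else x.

Fact valuation_ring_mulV :
  {in valuation_ring_unit, left_inverse 1 valuation_ring_inv *%R}.
Proof.
move=> x /asboolP ux; rewrite /valuation_ring_inv; case: pselect => // ex.
by case: (cid ex).
Qed.

Fact valuation_ring_unitP x y : y * x = 1 -> valuation_ring_unit x.
Proof. by move=> yx; apply/asboolP; exists y. Qed.

Fact valuation_ring_inv_out :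
  {in [predC valuation_ring_unit], valuation_ring_inv =1 id}.
Proof.
move=> x nux; rewrite /valuation_ring_inv; case: pselect => // ex.
by case/negP: nux; apply/asboolP.
Qed.

HB.instance Definition _ := GRing.ComNzRing_hasMulInverse.Build
  O valuation_ring_mulV valuation_ring_unitP valuation_ring_inv_out.

Fact valuation_ring_integral : GRing.integral_domain_axiom O.
Proof.
move=> x y /(congr1 val)/eqP; rewrite rmorphM rmorph0 mulf_eq0.
by rewrite -!(rmorph0 (val : O -> E)) !(inj_eq val_inj).
Qed.

HB.instance Definition _ :=
  GRing.ComUnitRing_isIntegral.Build O valuation_ring_integral.

Lemma valuation_ring_val_eq0 x : (val x == 0) = (x == 0).
Proof. by rewrite -(rmorph0 (val : O -> E)) (inj_eq val_inj). Qed.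

Lemma valuation_ge0 x : x != 0 -> 0 <= v (val x).
Proof.
rewrite -valuation_ring_val_eq0; have := valP x.
by rewrite /in_valuation_ring; case: eqP.
Qed.

Lemma valuationX (z : E) k : z != 0 -> v (z ^+ k) = v z *+ k.
Proof.
move=> z0; elim: k => [|k IHk]; first exact: valuation1.
by rewrite exprS valuationM ?expf_neq0 // IHk mulrS.
Qed.

Lemma valuationV (z : E) : z != 0 -> v z^-1 = - v z.
Proof.
move=> z0; apply/eqP; rewrite -addr_eq0 -valuationM ?invr_eq0 // mulVf //.
by rewrite valuation1.
Qed.

Lemma valuation_ring_dvd (x y : O) :
  y != 0 -> (x == 0) || (v (val y) <= v (val x)) -> exists e, x = e * y.
Proof.
have [->|x0 /=] := eqVneq x 0; first by exists 0; rewrite mul0r.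
move=> y0 vyx.
have vx0 : val x != 0 by rewrite valuation_ring_val_eq0.
have vy0 : val y != 0 by rewrite valuation_ring_val_eq0.
have eO : in_valuation_ring v (val x / val y).
  rewrite /in_valuation_ring valuationM ?invr_eq0 // valuationV // subr_ge0 vyx.
  by rewrite orbT.
exists (ValuationRing eO); apply: val_inj.
by rewrite rmorphM /= mulfVK.
Qed.

(** The values lie in the archimedean group of rationals, so a multiple of the
    positive value of a nonunit exceeds the value of d. *)
Lemma valuation_ring_archimedean : archimedean_divisibility O.
Proof.
move=> c d c0 d0.
have vc0 : val c != 0 by rewrite valuation_ring_val_eq0.
have := valuation_ge0 c0; rewrite le_eqVlt => /predU1P[vc|vc].
  left; have [|e ce] := @valuation_ring_dvd 1 c c0.
    by rewrite -vc rmorph1 valuation1 lexx orbT.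
  by apply/unitrP; exists e; rewrite [c * e]mulrC -ce.
right; pose k := Num.bound (v (val d) / v (val c)).
exists k; apply: valuation_ring_dvd => //.
rewrite rmorphXn valuationX // -mulr_natl -ler_pdivrMr //.
by rewrite (ltW (archi_boundP _)) ?orbT // divr_ge0 ?valuation_ge0.
Qed.

Lemma residue_natr k m : (k%:R : padic_int p_pr) m = (k %% p ^ m)%N.
Proof.
elim: k => [|k IHk]; first by rewrite mod0n residue0.
by rewrite mulrS /= IHk -!modz_nat modzDm.
Qed.

Lemma padic_int_natr_eq0 k : (k%:R == 0 :> padic_int p_pr) = (k == 0)%N.
Proof.
apply/eqP/eqP => [k0|-> //].
(* At level k the residue of k is k itself. *)
have kp : (k < p ^ k)%N by rewrite ltn_expl ?prime_gt1.
have := residue_natr k k; rewrite k0 residue0 modn_small // => kz.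
by case: kz.
Qed.

Lemma valuation_ring_natr_eq0 k : (k%:R == 0 :> O) = (k == 0)%N.
Proof.
rewrite -valuation_ring_val_eq0 rmorph_nat -scaler_nat.
rewrite scaler_eq0 oner_eq0 orbF -padic_int_natr_eq0.
by rewrite -(tofrac_eq0 (k%:R : padic_int p_pr)) rmorph_nat.
Qed.

End ValuationRingDomain.

(** * Projections onto blocks of coordinates *)

Section Blocks.

Variables (R : comNzRingType) (s : nat) (n : 'I_s -> nat).
Local Notation A := (coord_alg R (\sum_(i < s) n i)).

Lemma block_projM i : {morph @block_proj R s n i : x y / x * y}.
Proof. by move=> x y; apply/ffunP => j; rewrite !ffunE. Qed.

Lemma block_projZ i (c : R) (x : A) :
  block_proj i (c *: x) = c *: block_proj i x.
Proof. by apply/ffunP => j; rewrite !ffunE. Qed.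

Lemma block_proj_surj i (y : coord_alg R (n i)) :
  exists x : A, block_proj i x = y.
Proof.
exists [ffun k => if [pick j | tagnat.Rank i j == k] is Some j then y j else 0].
apply/ffunP => j; rewrite !ffunE; case: pickP => [j' | /(_ j)/eqP //].
by rewrite -val_eqE tagnat.eq_Rank eqxx => /eqP/val_inj ->.
Qed.

Lemma subalgebra_block i (T : set A) :
  is_subalgebra T -> is_subalgebra (block_proj i @` T).
Proof.
case=> T1 TD TM; split.
- by exists 1 => //; apply/ffunP => j; rewrite !ffunE.
- move=> c _ _ [x Tx <-] [y Ty <-]; exists (c *: x + y); first exact: TD.
  by apply/ffunP => j; rewrite !ffunE.
- move=> _ _ [x Tx <-] [y Ty <-]; exists (x * y); first exact: TM.
  exact: block_projM.
Qed.

Lemma image_multiples i (T : set A) a :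
  block_proj i @` multiples T a
    = multiples (block_proj i @` T) (block_proj i a).
Proof.
apply/seteqP; split=> [_ [_ [x Tx <-] <-]|_ [_ [x Tx <-] <-]].
  by exists (block_proj i x); [exists x | rewrite -block_projM].
by exists (x * a); [exists x | rewrite block_projM].
Qed.

Lemma prod_blocks (m : 'I_(\sum_(i < s) n i) -> nat) :
  (\prod_k m k = \prod_i \prod_j m (tagnat.Rank i j))%N.
Proof.
rewrite (reindex tagnat.rank) /=; last exact: tagnat.rank_bij_on.
rewrite sig_big_dep /=; apply: eq_bigr => u _.
by rewrite tagnat.rankE.
Qed.

End Blocks.

(** * Comparison of the indices *)

Theorem proposition2p3 (p : nat) (p_pr : prime p)
    (E : fieldExtType (padic p_pr)) (v : valuation_ext E)
    (s : nat) (s_gt0 : (0 < s)%N)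
    (n : 'I_s -> nat) (n_gt0 : forall i, (0 < n i)%N)
    (T J : set (coord_alg (valuation_ring v) (\sum_(i < s) n i)%N))
    (T_alg : is_subalgebra T) (T_local : complete_local T)
    (T_rank : has_rank T (\sum_(i < s) n i)%N)
    (J_ideal : is_ideal T J) (J_finite : finite_set (quotient_set T J))
    (J_principal : principal_ideal T J) :
  [set f : forall i : 'I_s, set (coord_alg (valuation_ring v) (n i)) |
     forall i, quotient_set (@block_proj _ s n i @` T)
                            (@block_proj _ s n i @` J) (f i)]
  #= quotient_set T J.
Proof.
case: J_principal J_finite => a Ta -> J_finite.
have char0 := @valuation_ring_natr_eq0 _ _ _ v.
have a0 := finite_quotient_neq0 char0 T_alg J_finite.
pose m j := projT1 (cid (quotient_coord_index T_alg J_finite j)).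
have am j : has_index [set: valuation_ring v] (multiples setT (a j)) (m j).
  by rewrite /m; case: cid.
have [d d0 dT] := full_rank_conductor T_alg T_rank.
have archO := @valuation_ring_archimedean _ _ _ v.
have T_index := index_multiples archO T_alg d0 dT Ta a0 am.
have T_sub := subgroup_multiples a (subgroup_subalgebra T_alg).
have Ti_alg i := subalgebra_block i T_alg.
pose ai i : coord_alg (valuation_ring v) (n i) := block_proj i a.
have Ti_sub i := subgroup_multiples (ai i) (subgroup_subalgebra (Ti_alg i)).
pose mi i := (\prod_j m (tagnat.Rank i j))%N.
have Ti_index i : has_index (block_proj i @` T)
                    (multiples (block_proj i @` T) (ai i)) (mi i).
  apply: (index_multiples archO (Ti_alg i) d0).
  - move=> y; have [x <-] := block_proj_surj y; exists (d *: x) => //.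
    exact: block_projZ.
  - by exists a.
  - by move=> j; rewrite ffunE.
  - by move=> j; rewrite ffunE.
have qP i : exists q : 'I_(mi i) -> set (coord_alg (valuation_ring v) (n i)),
    injective q /\ quotient_set (block_proj i @` T)
                     (multiples (block_proj i @` T) (ai i)) = range q.
  have [r /(quotient_set_range (Ti_sub i)) rP] := Ti_index i.
  by eexists; exact: rP.
pose q i := projT1 (cid (qP i)).
have qE i : injective (q i) /\ quotient_set (block_proj i @` T)
                     (multiples (block_proj i @` T) (ai i)) = range (q i).
  by rewrite /q; case: cid.
rewrite [X in X #= _](_ : _ = [set f | forall i, range (q i) (f i)]).
  rewrite (card_eqr (card_quotient_set T_sub T_index)) prod_blocks.
  by apply: card_eq_pi => i; exact: (qE i).1.
apply/seteqP; split=> f fq i; have := fq i;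
  by rewrite image_multiples (qE i).2.
Qed.
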